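(* Let $G$ be a finite abelian $p$-group for a prime $p$, let $\psi:G\to\mathbb{Z}_{p^{\alpha_1}}\times\mathbb{Z}_{p^{\alpha_2}}\times\cdots\times\mathbb{Z}_{p^{\alpha_r}}$ (with $r\in\mathbb{N}$, $\alpha_i\in\mathbb{N}$) be an isomorphism, and let $t$ be an index with $\tau(G)=p^{\alpha_t}$. If $g\in G$ is such that all components of $\psi(g)$ are $\overline{0}$ except the $t$-th, which is $\overline{a}$ with $\gcd(a,p)=1$, then $E\big[g,\ \psi^{-1}(\langle\psi(g)\rangle)\setminus\{g\}\big]$ is a minimum disconnecting set of $\mathcal{G}(G)$.
   Context: $\mathbb{Z}_m$ is the additive group of integers modulo $m$. A finite abelian group $G$ is isomorphic to a unique direct product of cyclic groups of prime power order; $\tau(G)$ is the order of the smallest cyclic factor. The power graph $\mathcal{G}(G)$ has vertex set $G$, distinct $u,v$ adjacent iff one is a positive integer power of the other. $E[x,B]$ is the set of edges with one end $x$ and the other in $B$. A disconnecting set is a set of edges whose removal increases the number of components; a minimum disconnecting set is one of least cardinality. *)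

(* Defs.v *)
From HB Require Import structures.
From mathcomp Require Export all_boot all_order all_algebra all_fingroup.
From mathcomp Require Export all_solvable.

Set Implicit Arguments.
Unset Strict Implicit.
Unset Printing Implicit Defensive.

Import GroupScope.

(* A graph on the vertex type T is a symmetric irreflexive e : rel T; an edge is
   the unordered pair [set x; y] of its ends. *)
Section Graphs.
Variables (T : finType) (e : rel T).

Definition edges : {set {set T}} :=
  [set [set xy.1; xy.2] | xy : T * T & e xy.1 xy.2].

Definition edges_between (x : T) (B : {set T}) : {set {set T}} :=
  [set f in edges | [exists b in B, f == [set x; b]]].

Definition delete_edges (F : {set {set T}}) : rel T :=
  [rel x y | e x y && ([set x; y] \notin F)].

Definition disconnecting (F : {set {set T}}) : Prop :=
  F \subset edges /\ (n_comp e T < n_comp (delete_edges F) T)%N.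

Definition minimum_disconnecting (F : {set {set T}}) : Prop :=
  disconnecting F /\
  forall F' : {set {set T}}, disconnecting F' -> (#|F| <= #|F'|)%N.

End Graphs.

(* u is one of v ^+ 1, ..., v ^+ #[v]; larger exponents give nothing new, see
   positive_powerP. *)
Definition positive_power (G : finGroupType) (u v : G) : bool :=
  [exists n : 'I_#[v], u == v ^+ n.+1].

Lemma positive_powerP (G : finGroupType) (u v : G) :
  reflect (exists2 n : nat, (0 < n)%N & u = v ^+ n) (positive_power u v).
Proof.
apply: (iffP existsP) => [[n /eqP->]|[n n_gt0 ->]]; first by exists n.+1.
exists (Ordinal (ltn_pmod n.-1 (order_gt0 v))).
by rewrite /= !expgS expg_mod_order -expgS prednK.
Qed.

Definition power_graph (G : finGroupType) : rel G :=
  [rel u v | (u != v) && (positive_power u v || positive_power v u)].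

Lemma power_graph_sym (G : finGroupType) : symmetric (@power_graph G).
Proof. by move=> u v; rewrite /power_graph /= eq_sym orbC. Qed.

(* The finGroupType instance of 'Z_n is the additive one. *)
Definition Zgroup_type (n : nat) : finGroupType := 'Z_n.

(* The direct product of the Z_(q i); since 'Z_0 and 'Z_1 both denote Z/2, it is
   only meaningful when every q i is at least 2. *)
Definition Zprod (r : nat) (q : 'I_r -> nat) : finGroupType :=
  {dffun forall i : 'I_r, Zgroup_type (q i)}.

Definition Zcomp (r : nat) (q : 'I_r -> nat) (x : Zprod q) (i : 'I_r) :
  'Z_(q i) := (x : {dffun forall i : 'I_r, Zgroup_type (q i)}) i.

Lemma ZcompM (r : nat) (q : 'I_r -> nat) (x y : Zprod q) (i : 'I_r) :
  Zcomp (x * y) i = (Zcomp x i + Zcomp y i)%R.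
Proof. by rewrite /Zcomp mulg_ffun. Qed.

Definition prime_power (q : nat) : Prop :=
  exists p k : nat, [/\ prime p, (0 < k)%N & q = (p ^ k)%N].

(* tau(G) = m. The decomposition is unique up to the order of the factors, so m
   is determined by G; the trivial group has no factor and no tau. *)
Definition is_tau (G : finGroupType) (m : nat) : Prop :=
  exists (r : nat) (q : 'I_r -> nat),
    [/\ forall i, prime_power (q i),
        [set: G] \isog [set: Zprod q],
        exists i, q i = m
      & forall i, (m <= q i)%N].

(* Main.v *)
(** Since the [t]-th component of [g] is a unit, [g] is a power of [u] only if
    [<[u]> = <[g]>], so the edges of the statement are all those at [g], and
    there are at most [tau(G) - 1] of them. Conversely, a nontrivial [x] cut off
    from the identity lies in [<[y]>] for some [y] that is not a [p]-th power;
    some component of [y] is then prime to [p], which forces [#[y] >= tau(G)].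
    The cyclic [p]-group [<[y]>] is a clique of the power graph meeting both
    sides of the cut, so at least [#[y] - 1] edges were removed. *)

Require Import Defs.

Set Implicit Arguments.
Unset Strict Implicit.
Unset Printing Implicit Defensive.

Import GroupScope GRing.Theory.

Lemma n_comp_gt1P (T : finType) (e : rel T) (x0 : T) : symmetric e ->
  reflect (exists x, ~~ connect e x0 x) (1 < n_comp e T)%N.
Proof.
move=> /sym_connect_sym csym.
apply: (iffP idP) => [|[x ncx]].
  move=> gt1; apply/existsP; apply: contraLR gt1.
  rewrite negb_exists -leqNgt => /forallP conn.
  rewrite -(n_comp_connect csym x0) leq_eqVlt; apply/orP; left; apply/eqP.
  apply: eq_n_comp_r => x; rewrite !inE; symmetry.
  by move: (conn x); rewrite negbK.
apply/card_gt1P; exists (fingraph.root e x0), (fingraph.root e x).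
split; rewrite ?inE ?roots_root //.
by rewrite (root_connect csym).
Qed.

Section EdgeCuts.
Variables (T : finType) (e : rel T).
Hypothesis e_sym : symmetric e.

Lemma delete_edges_sym (F : {set {set T}}) : symmetric (delete_edges e F).
Proof. by move=> x y; rewrite /delete_edges /= e_sym setUC. Qed.

Lemma mem_edges (x y : T) : e x y -> [set x; y] \in edges e.
Proof. by move=> exy; apply/imsetP; exists (x, y); rewrite ?inE. Qed.

(** Deleting [F] leaves [x] without neighbours, hence cut off from [x0], while the original graph
    has a single component. *)
Lemma isolating_disconnecting (F : {set {set T}}) (x0 x : T) :
    (forall y, connect e x0 y) -> x != x0 -> F \subset edges e ->
    (forall y, e x y -> [set x; y] \in F) ->
  disconnecting e F.
Proof.
move=> conn nx0 sF Fx; split=> //.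
apply: (@leq_trans 2).
  rewrite ltnS leqNgt; apply/negP=> /(n_comp_gt1P x0 e_sym)[y].
  by rewrite conn.
apply/(n_comp_gt1P x (delete_edges_sym F)); exists x0.
apply/negP=> /connectP[[|y q] /=].
  by move=> _ /eqP; rewrite eq_sym (negPf nx0).
by case/andP=> /andP[/Fx ->].
Qed.

(* A clique meeting both sides of a cut, in s and c - s vertices, has
   s (c - s) >= c - 1 edges across the cut. *)
Lemma clique_cut (F : {set {set T}}) (C : {set T}) (x y : T) :
    {in C &, forall u v, u != v -> e u v} -> x \in C -> y \in C ->
    ~~ connect (delete_edges e F) x y ->
  (#|C|.-1 <= #|F|)%N.
Proof.
move=> cliqueC Cx Cy ncxy; set d := delete_edges e F.
pose A := [set u in C | connect d x u]; pose B := [set u in C | ~~ connect d x u].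
have cardC : (#|A| + #|B| = #|C|)%N.
  rewrite -(cardsID [set u | connect d x u] C); congr (_ + _)%N.
    by apply: eq_card => u; rewrite !inE.
  by apply: eq_card => u; rewrite !inE andbC.
have A_gt0 : (0 < #|A|)%N by apply/card_gt0P; exists x; rewrite inE Cx connect0.
have B_gt0 : (0 < #|B|)%N by apply/card_gt0P; exists y; rewrite inE Cy.
pose edge (uv : T * T) := [set uv.1; uv.2].
have AB_neq u v : u \in A -> v \in B -> u != v.
  rewrite !inE => /andP[_ cu] /andP[_]; apply: contraNneq => <-; exact: cu.
(* Since [A] and [B] are disjoint, an unordered pair with one end in each determines which end is
   which. *)
have edge_inj : {in setX A B &, injective edge}.
  move=> [u v] [u' v'] /setXP[/= Au Bv] /setXP[/= Au' Bv'] /setP eq_uv.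
  have := eq_uv u; rewrite /edge !inE eqxx /= (negPf (AB_neq _ _ Au Bv')) orbF.
  have := eq_uv v; rewrite /edge !inE eqxx orbT /=.
  rewrite (eq_sym v u') (negPf (AB_neq _ _ Au' Bv)) /=.
  by move=> /esym/eqP-> /esym/eqP->.
have: edge @: setX A B \subset F.
  apply/subsetP=> _ /imsetP[[u v] /setXP[/= Au Bv] ->].
  have nuv := AB_neq _ _ Au Bv; move: Au Bv; rewrite !inE => /andP[Cu cu] /andP[Cv].
  apply: contraR => nF; apply: connect_trans cu (connect1 _).
  by rewrite /d /delete_edges /= cliqueC.
move/subset_leq_card; rewrite (card_in_imset edge_inj) cardsX.
apply: leq_trans; rewrite -cardC.
case: #|A| A_gt0 => // i _; case: #|B| B_gt0 => // j _.
by rewrite addSn /= mulSn mulnS addnCA leq_add2l leq_addr.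
Qed.

End EdgeCuts.

Section PowerGraph.
Variable G : finGroupType.

Lemma positive_powerE (u v : G) : positive_power u v = (u \in <[v]>).
Proof.
apply/positive_powerP/cycleP => [[n _ ->]|[n ->]]; first by exists n.
(* Adding the order keeps the power and makes the exponent positive even when [n] is 0. *)
exists (n + #[v])%N; first by rewrite addn_gt0 order_gt0 orbT.
by rewrite expgD expg_order mulg1.
Qed.

Lemma power_graph_connected (x : G) : connect (@power_graph G) 1 x.
Proof.
have [->|nx1] := eqVneq x 1; first exact: connect0.
by apply: connect1; rewrite /power_graph /= !positive_powerE group1 eq_sym nx1.
Qed.

(** Element orders in [<[y]>] are powers of [p], so one of any two divides the other; in a cyclic
    group this divisibility gives inclusion of the generated subgroups. *)
Lemma cycle_p_elt_clique (p : nat) (y : G) :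
  p.-elt y -> {in <[y]> &, forall u v, u != v -> power_graph u v}.
Proof.
move=> py u v yu yv nuv; rewrite /power_graph /= nuv /= !positive_powerE.
have sub w w' : w \in <[y]> -> w' \in <[y]> -> (#[w] %| #[w'])%N -> w \in <[w']>.
  by rewrite -!cycle_subG => yw yw'; rewrite (cardSg_cyclic (cycle_cyclic y)).
have [i ou] := p_natP (mem_p_elt py yu); have [j ov] := p_natP (mem_p_elt py yv).
case/orP: (leq_total i j) => [le|le]; apply/orP; [left | right];
  by apply: sub => //; rewrite ou ov dvdn_exp2l.
Qed.

End PowerGraph.

Section Zprod.
Variables (r : nat) (q : 'I_r -> nat).
Implicit Types x y : Zprod q.

Lemma ZcompX x n i : Zcomp (x ^+ n) i = (Zcomp x i *+ n)%R.
Proof.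
elim: n => [|n IHn]; first by rewrite /Zcomp oneg_ffun.
by rewrite expgS ZcompM IHn mulrS.
Qed.

Lemma Zcomp_inj x y : (forall i, Zcomp x i = Zcomp y i) -> x = y.
Proof. by move=> eq_xy; apply/ffunP => i; exact: eq_xy. Qed.

Lemma not_power_order_ge (p m : nat) (y : Zprod q) : prime p ->
    (forall i, prime_power (q i)) -> (forall i, m <= q i)%N ->
    p.-elt y -> (forall z, z ^+ p <> y) ->
  (m <= #[y])%N.
Proof.
move=> p_pr q_pp le_m py ny.
have /existsP[i ndvd] : [exists i, ~~ (p %| Zcomp y i)%N].
  rewrite -negb_forall; apply/negP=> /forallP dvd.
  (* If [p] divided the representatives of all components, dividing each of them by [p] would give a
     [p]-th root of [y]. *)
  pose z : Zprod q := [ffun i => (Zcomp y i %/ p)%:R%R : Zgroup_type (q i)].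
  apply: (ny z); apply: Zcomp_inj => i.
  by rewrite ZcompX {1}/Zcomp ffunE -mulrnA divnK // natr_Zp.
apply: leq_trans (le_m i) _.
have [l [k [l_pr k_gt0 qE]]] := q_pp i.
have q_gt1 : (1 < q i)%N by rewrite qE -(exp1n k) ltn_exp2r ?prime_gt1.
have dvd_q : (q i %| Zcomp y i * #[y])%N.
  have := congr1 (fun x => Zcomp x i) (expg_order y).
  rewrite ZcompX -{1}(natr_Zp (Zcomp y i)) -mulrnA => /(congr1 val).
  rewrite /= val_Zp_nat // {2}/Zcomp oneg_ffun /= => /eqP; exact.
have lt_q : (Zcomp y i < q i)%N.
  by have := ltn_ord (Zcomp y i); rewrite [X in (_ < X)%N](Zp_cast q_gt1).
move: (nat_of_ord (Zcomp y i)) ndvd dvd_q lt_q => v ndvd dvd_q lt_q.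
(* Here [q i] divides [v * #[y]]. If [q i] is a power of [p], it is coprime to [v] and so divides
   [#[y]]. Otherwise it is coprime to [#[y]] and divides [v], which is impossible as
   [0 < v < q i]. *)
have [n oy] := p_natP py; have [lp|lp] := eqVneq l p.
  apply: dvdn_leq => //; move: dvd_q; rewrite Gauss_dvdr //.
  by rewrite qE lp coprimeXl // prime_coprime.
move: dvd_q; rewrite Gauss_dvdl; last first.
  by rewrite oy qE coprimeXl // coprimeXr // prime_coprime // dvdn_prime2.
have v_gt0 : (0 < v)%N by case: v ndvd {lt_q} => //; rewrite dvdn0.
by move/(dvdn_leq v_gt0); rewrite leqNgt lt_q.
Qed.

End Zprod.

Section PGroup.
Variables (p : nat) (G : finGroupType).
Hypotheses (p_pr : prime p) (pG : p.-group [set: G]).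

Lemma p_eltT (x : G) : p.-elt x.
Proof. by apply: mem_p_elt pG _; rewrite inE. Qed.

(** Take [y] of maximal order among the elements whose cyclic group contains [x]: a [p]-th root of
    [y] would be another such element, of order [p] times larger. *)
Lemma nonpower_root (x : G) : x != 1 ->
  exists2 y, x \in <[y]> & forall z, z ^+ p <> y.
Proof.
move=> nx1; pose y := [arg max_(w > x | x \in <[w]>) #[w]].
have [xy ymax] : x \in <[y]> /\ forall w, x \in <[w]> -> (#[w] <= #[y])%N.
  by rewrite /y; case: arg_maxnP => [|w]; rewrite ?cycle_id.
exists y => // z zy.
have xz : x \in <[z]> by apply: subsetP xy; rewrite cycle_subG -zy mem_cycle.
have [n oz] := p_natP (p_eltT z).
have n_gt0 : (0 < n)%N.
  rewrite lt0n; apply: contraNneq nx1 => n0.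
  move: oz xz; rewrite n0 expn0 => /eqP; rewrite order_eq1 => /eqP->.
  by rewrite cycle1 inE.
have := ymax z xz; rewrite -zy orderXdiv oz; last by rewrite dvdn_exp.
by rewrite leqNgt ltn_Pdiv ?prime_gt1 ?expn_gt0 ?prime_gt0.
Qed.

Lemma tau_cycle (m : nat) (x : G) : is_tau G m -> x != 1 ->
  exists2 y, x \in <[y]> & (m <= #[y])%N.
Proof.
move=> [s [q [q_pp /isogP[f injf imf] _ le_m]]] nx1.
have [y xy ny] := nonpower_root nx1; exists y => //.
rewrite -(order_injm injf) ?inE //.
apply: (not_power_order_ge p_pr q_pp le_m).
  by rewrite /p_elt order_injm ?inE //; exact: p_eltT.
move=> z; have: z \in f @* [set: G] by rewrite imf inE.
case/morphimP=> w _ _ ->; rewrite -morphX ?inE // => /(injmP injf) eqw.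
by apply: (ny w); apply: eqw; rewrite inE.
Qed.

Lemma tau_le_disconnecting (m : nat) (F : {set {set G}}) :
  is_tau G m -> disconnecting (@power_graph G) F -> (m.-1 <= #|F|)%N.
Proof.
move=> tauG [_ gt1].
have dsym := delete_edges_sym (@power_graph_sym G) F.
(* The power graph has at least one component, so the strict increase leaves at least two. *)
have /(n_comp_gt1P 1 dsym)[x nc1x] :
    (1 < n_comp (delete_edges (@power_graph G) F) G)%N.
  apply: leq_ltn_trans gt1; apply/card_gt0P.
  exists (fingraph.root (@power_graph G) 1).
  by rewrite !inE roots_root //; apply: sym_connect_sym; exact: power_graph_sym.
have nx1 : x != 1 by apply: contraNneq nc1x => ->; exact: connect0.
have [y xy le_m] := tau_cycle tauG nx1.
apply: (@leq_trans #[y].-1); first by rewrite -!subn1 leq_sub2r.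
exact: (clique_cut (cycle_p_elt_clique (p_eltT y)) (group1 _) xy nc1x).
Qed.

End PGroup.

Theorem theorem5p2 (p : nat) (p_prime : prime p)
    (G : finGroupType) (G_abelian : abelian [set: G]) 
    (G_pgroup : (p.-group [set: G])%g)
    (r : nat) (alpha : 'I_r -> nat) (alpha_gt0 : forall i, (0 < alpha i)%N)
    (psi : G -> Zprod (fun i => (p ^ alpha i)%N))
    (psi_morph : {morph psi : x y / (x * y)%g}) (psi_bij : bijective psi)
    (t : 'I_r) (tau_t : is_tau G (p ^ alpha t)%N)
    (g : G) (a : int) (a_coprime : coprimez a p)
    (psi_g_t : Zcomp (psi g) t = (a%:~R)%R)
    (psi_g_0 : forall i : 'I_r, i != t -> Zcomp (psi g) i = 0%R) :
  minimum_disconnecting (@power_graph G)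
    (edges_between (@power_graph G) g
       ((psi @^-1: <[psi g]>%g) :\ g)).
Proof.
set m := (p ^ alpha t)%N in tau_t *.
have m_gt1 : (1 < m)%N by rewrite /m -(exp1n (alpha t)) ltn_exp2r ?prime_gt1.
have psi1 : psi 1 = 1 by apply: (mulgI (psi 1)); rewrite -psi_morph !mulg1.
have psiX x n : psi (x ^+ n) = psi x ^+ n.
  by elim: n => [|n IHn]; rewrite ?psi1 // !expgS psi_morph IHn.
(* The inverse is the Bezout coefficient of [a] modulo [p ^ alpha t]. *)
have a_unit : (a%:~R : 'Z_m)%R \is a GRing.unit.
  have /coprimezP[[u v] /= uv] : coprimez a (p%:Z ^+ alpha t)%R.
    by rewrite coprimezXr.
  apply/GRing.unitrP; exists (u%:~R)%R.
  have ua : (u%:~R * a%:~R = 1 :> 'Z_m)%R.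
    have := congr1 (fun z : int => z%:~R : 'Z_m)%R uv.
    by rewrite rmorphD !rmorphM /= rmorphXn /= -natrX pchar_Zp // mulr0 addr0.
  by split=> //; rewrite mulrC.
(* If [g = u ^+ n], the [t]-th component of [psi g] is a unit and a multiple of [n], so [n] is prime
   to [p], hence to the order of [psi u]; then [psi u] and [psi g] generate the same subgroup. *)
have nbr_g u : power_graph g u -> u \in psi @^-1: <[psi g]> :\ g.
  rewrite /power_graph /= !positive_powerE !inE eq_sym => /andP[-> /=].
  case/orP=> /cycleP[n]; last by move=> ->; rewrite psiX mem_cycle.
  move=> gE; rewrite gE psiX.
  suff: coprime #[psi u] n.
    by rewrite -generator_coprime => /eqP <-; exact: cycle_id.
  have n_cop : coprime p n.
    move: a_unit; rewrite -psi_g_t gE psiX ZcompX -mulr_natr unitrM unitZpE //.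
    by rewrite coprime_pexpl // => /andP[].
  have [k ou] := p_natP (p_eltT G_pgroup u).
  apply: (@coprime_dvdl _ #[u]); last by rewrite ou coprimeXl.
  by rewrite order_dvdn -psiX expg_order psi1.
split.
  apply: (isolating_disconnecting (x := g) (@power_graph_sym G)
            (@power_graph_connected G)) => [||u gu].
  - apply: contraTneq a_unit => g1; rewrite -psi_g_t g1 psi1 /Zcomp oneg_ffun.
    by rewrite unitr0.
  - by apply/subsetP=> f; rewrite inE => /andP[].
  - rewrite inE mem_edges //=; apply/exists_inP; exists u => //; exact: nbr_g.
move=> F disF; apply: leq_trans (tau_le_disconnecting p_prime G_pgroup tau_t disF).
set B := _ :\ g.
have: edges_between (@power_graph G) g B \subset [set [set g; b] | b in B].
  apply/subsetP=> f; rewrite inE => /andP[_ /exists_inP[b Bb /eqP->]].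
  exact: imset_f.
move/subset_leq_card/leq_trans; apply; apply: leq_trans (leq_imset_card _ _) _.
have gB : g \in psi @^-1: <[psi g]> by rewrite inE cycle_id.
(* Removing [g] accounts for the predecessor; it remains that the order of [psi g] divides [m], its
   only nonzero component lying in ['Z_m]. *)
rewrite -ltnS prednK ?(ltnW m_gt1) // (leq_trans (n := #|psi @^-1: <[psi g]>|)) //.
  by rewrite [X in (_ < X)%N](cardsD1 g) gB.
rewrite on_card_preimset; last by apply: onW_bij.
apply: dvdn_leq (ltnW m_gt1) _; rewrite order_dvdn; apply/eqP/Zcomp_inj => i.
rewrite ZcompX {2}/Zcomp oneg_ffun; have [->|nit] := eqVneq i t.
  by rewrite -mulr_natr pchar_Zp // mulr0.
by rewrite psi_g_0 // mul0rn.
Qed.
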